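(* Let $\mathbf G$ and $\mathbf K$ be finite abelian groups each having exactly two (nontrivial) Sylow subgroups, i.e. each of order divisible by exactly two primes. If $\mathcal D(\mathbf G)\cong\mathcal D(\mathbf K)$, then $\mathbf G\cong\mathbf K$.
   Context: The power graph of a group $\mathbf L$ is the simple graph on $L$ in which two distinct elements are adjacent iff one is a power of the other; the enhanced power graph of $\mathbf L$ is the simple graph on $L$ in which two distinct elements are adjacent iff they generate a cyclic subgroup. The difference graph $\mathcal D(\mathbf L)$ is the graph whose edges are the pairs adjacent in the enhanced power graph but not in the power graph, with all isolated vertices removed; $\cong$ between graphs denotes graph isomorphism. *)

(* Defs.v *)
From HB Require Import structures.
From mathcomp Require Import all_boot all_fingroup all_solvable.

Set Implicit Arguments.
Unset Strict Implicit.
Unset Printing Implicit Defensive.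

Local Open Scope group_scope.

Record sgraph (T : finType) := SGraph {
  adj :> rel T;
  adj_sym : symmetric adj;
  adj_irr : irreflexive adj
}.

Definition graph_iso (T U : finType) (g : sgraph T) (h : sgraph U) : Prop :=
  exists2 f : T -> U, bijective f & forall x y, h (f x) (f y) = g x y.

Section Operations.

Variable T : finType.
Implicit Types g h : sgraph T.

Definition edge_diff_rel g h : rel T := fun x y => g x y && ~~ h x y.

Fact edge_diff_sym g h : symmetric (edge_diff_rel g h).
Proof. by move=> x y; rewrite /edge_diff_rel !(adj_sym _ x y). Qed.

Fact edge_diff_irr g h : irreflexive (edge_diff_rel g h).
Proof. by move=> x; rewrite /edge_diff_rel adj_irr. Qed.

Definition edge_diff g h : sgraph T :=
  SGraph (edge_diff_sym g h) (edge_diff_irr g h).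

Definition non_isolated g : pred T := fun x => [exists y, g x y].

Definition delete_isolated_rel g : rel {x : T | non_isolated g x} :=
  fun x y => g (val x) (val y).

Fact delete_isolated_sym g : symmetric (@delete_isolated_rel g).
Proof. by move=> x y; apply: adj_sym. Qed.

Fact delete_isolated_irr g : irreflexive (@delete_isolated_rel g).
Proof. by move=> x; apply: adj_irr. Qed.

Definition delete_isolated g : sgraph {x : T | non_isolated g x} :=
  SGraph (@delete_isolated_sym g) (@delete_isolated_irr g).

End Operations.

Section PowerGraphs.

Variables (gT : finGroupType) (G : {group gT}).

(* In a finite group, membership in <[y]> is being a power of y (cycleP). *)
Definition power_rel : rel (subg_of G) := fun x y =>
  (x != y) && ((x \in <[y]>) || (y \in <[x]>)).

Fact power_sym : symmetric power_rel.
Proof. by move=> x y; rewrite /power_rel eq_sym orbC. Qed.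

Fact power_irr : irreflexive power_rel.
Proof. by move=> x; rewrite /power_rel eqxx. Qed.

Definition power_graph : sgraph (subg_of G) := SGraph power_sym power_irr.

Definition enhanced_power_rel : rel (subg_of G) := fun x y =>
  (x != y) && cyclic <<[set x; y]>>.

Fact enhanced_power_sym : symmetric enhanced_power_rel.
Proof. by move=> x y; rewrite /enhanced_power_rel eq_sym setUC. Qed.

Fact enhanced_power_irr : irreflexive enhanced_power_rel.
Proof. by move=> x; rewrite /enhanced_power_rel eqxx. Qed.

Definition enhanced_power_graph : sgraph (subg_of G) :=
  SGraph enhanced_power_sym enhanced_power_irr.

Definition difference_graph :=
  delete_isolated (edge_diff enhanced_power_graph power_graph).

End PowerGraphs.

(* Main.v *)
(** A group [G] with exactly two Sylow subgroups [P] and [Q] is a set of pairs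
    [(a, b)].  Writing [a < c] when [<a>] is a proper subgroup of [<c>], the
    pairs [(a, b)] and [(c, d)] are adjacent in the difference graph iff
    [a < c] and [d < b], or [c < a] and [b < d].  Hence the neighbourhood of
    [(a, b)] is the union of [above a * below b] and [below a * above b], and
    these two sets are completely joined.

    The vertices whose neighbourhood is not a join are exactly those for which
    one of the two sets is empty and the other is not; they induce a connected
    bipartite graph, one side of which contains all [(1, b)] and the other all
    [(a, 1)].  So an isomorphism preserves the two sides, up to exchange.

    A vertex of maximal degree on the first side is some [(1, b)], with [b] of
    maximal order, and its twins are the [(1, c)] with [<c^q> = <b^q>].  If
    [b^q <> 1], their number has [q] as its largest prime divisor, and a vertex
    [(1, z)] with [z] of order [q] has fewer twins; if [b^q = 1], their number
    is [|Q| - 1], and it is minimal on this side.  So the graph determines [q],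
    and likewise [p].  Finally the vertices [(1, b)] are those of their side
    whose degree is prime to [p], and the degree [(|P| - 1) #[b] / q] of
    [(1, b)] gives the order of [b].  An abelian group is determined by the
    numbers of its elements of each order. *)

Require Import Defs.
From HB Require Import structures.
From mathcomp Require Import all_boot all_fingroup all_solvable.

Set Implicit Arguments.
Unset Strict Implicit.
Unset Printing Implicit Defensive.

Local Open Scope group_scope.

(** * Isomorphism of graphs up to isolated vertices *)

Section GraphInvariants.

Variables (T : finType) (g : rel T).

Definition nbr (x : T) : {set T} := [set y | g x y].

Definition twins (x : T) : {set T} := [set z | nbr z == nbr x].

(* The second condition says that the complement of the graph induced on the
   neighbourhood of [x] is connected, of diameter at most 3. *)
Definition coconn (x : T) : Prop :=
  (exists y, g x y) /\
  forall y z, g x y -> g x z -> exists v w,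
    [/\ g x v, g x w & [/\ ~~ g y v, ~~ g v w & ~~ g w z]].

(** The length is even, so in the bipartite graph on the co-connected pairs such a walk never leaves
    a side; length 4 suffices to join any two vertices of one side. *)
Definition coconn_path4 (x y : T) : Prop :=
  exists v w u, [/\ coconn v, coconn w, coconn u &
                 [/\ g x v, g v w, g w u & g u y]].

End GraphInvariants.

(* [f] and [f'] are defined on all vertices, but are mutually inverse only on
   the non-isolated ones. *)
Definition core_iso (T U : finType) (g : rel T) (h : rel U)
    (f : T -> U) (f' : U -> T) : Prop :=
  [/\ {mono f : x y / g x y >-> h x y}, {mono f' : x y / h x y >-> g x y},
      forall x y, g x y -> f' (f x) = x & forall x y, h x y -> f (f' x) = x].

Section CoreIso.

Variables (T U : finType) (g : rel T) (h : rel U) (f : T -> U) (f' : U -> T).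

Lemma core_iso_sym : core_iso g h f f' -> core_iso h g f' f.
Proof. by case. Qed.

Lemma core_iso_comp (W : finType) (k : rel W) (e : U -> W) (e' : W -> U) :
  core_iso g h f f' -> core_iso h k e e' ->
  core_iso g k (e \o f) (f' \o e').
Proof.
case=> fM f'M fK f'K [eM e'M eK e'K]; split=> [x y|x y|x y gxy|x y kxy] /=.
- by rewrite eM fM.
- by rewrite f'M e'M.
- by rewrite (eK _ (f y)) ?fM // (fK _ y).
- by rewrite (f'K _ (e' y)) ?e'M // (e'K _ y).
Qed.

Hypotheses (g_sym : symmetric g) (h_sym : symmetric h).
Hypothesis fP : core_iso g h f f'.

Lemma core_iso_nbr x : nbr h (f x) = f @: nbr g x.
Proof.
case: fP => fM f'M fK f'K; apply/setP=> y; rewrite inE.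
apply/idP/imsetP=> [hxy|[z]]; last by rewrite inE => gxz ->; rewrite fM.
have yK: f (f' y) = y by apply: f'K (f x) _; rewrite h_sym.
by exists (f' y); rewrite ?yK // inE -fM yK.
Qed.

Lemma core_iso_card_nbr x : #|nbr h (f x)| = #|nbr g x|.
Proof.
case: fP => fM f'M fK f'K; rewrite core_iso_nbr card_in_imset // => y z.
rewrite !inE => gxy gxz eq_f.
by rewrite -(fK y x) 1?g_sym // eq_f (fK z x) // g_sym.
Qed.

(** Twins of [x] are adjacent to [y] as well, hence non-isolated, and [f] is injective on such
    vertices. Isolated vertices are twins of one another, and their number may change. *)
Lemma core_iso_leq_twins x y : g x y -> #|twins g x| <= #|twins h (f x)|.
Proof.
move=> gxy; case: (fP) => fM f'M fK f'K.
have twx z : z \in twins g x -> g z y.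
  by rewrite inE => /eqP/setP/(_ y); rewrite !inE gxy.
rewrite -(card_in_imset (f := f) (D := mem (twins g x))); last first.
  move=> z1 z2 /twx gz1 /twx gz2 eq_f.
  by rewrite -(fK z1 y) // eq_f (fK z2 y).
apply/subset_leq_card/subsetP=> _ /imsetP[z + ->].
by rewrite !inE !core_iso_nbr => /eqP->.
Qed.

Lemma core_iso_coconn x : coconn g x -> coconn h (f x).
Proof.
case: fP => fM f'M fK f'K [[y gxy] ccx].
split; first by exists (f y); rewrite fM.
have lift z : h (f x) z -> exists2 t, g x t & z = f t.
  move=> hxz; have: z \in nbr h (f x) by rewrite inE.
  by rewrite core_iso_nbr => /imsetP[t]; rewrite inE; exists t.
move=> _ _ /lift[s gxs ->] /lift[t gxt ->].
have [v [w [gxv gxw [sv vw wt]]]] := ccx _ _ gxs gxt.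
by exists (f v), (f w); rewrite !fM.
Qed.

Lemma core_iso_path4 x y : coconn_path4 g x y -> coconn_path4 h (f x) (f y).
Proof.
case: (fP) => fM _ _ _ [v [w [u [Jv Jw Ju edges]]]].
exists (f v), (f w), (f u); rewrite !fM.
by split=> //; apply: core_iso_coconn.
Qed.

End CoreIso.

Lemma core_iso_twins (T U : finType) (g : rel T) (h : rel U) f f' :
  symmetric g -> symmetric h -> core_iso g h f f' ->
  forall x y, g x y -> #|twins h (f x)| = #|twins g x|.
Proof.
move=> g_sym h_sym fP x y gxy; have [fM _ fK _] := fP.
apply/eqP; rewrite eqn_leq (core_iso_leq_twins h_sym fP gxy) andbT.
rewrite -{2}(fK x y gxy).
by apply: (core_iso_leq_twins g_sym (core_iso_sym fP) (y := f y)); rewrite fM.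
Qed.

Lemma non_isolated_ex (T : finType) (g : sgraph T) x y :
  g x y -> exists u : {x | non_isolated g x}, x = val u.
Proof.
move=> gxy; have nx: non_isolated g x by apply/existsP; exists y.
by exists (exist _ x nx).
Qed.

Section DeleteIsolated.

Variables (T U : finType) (g : sgraph T) (h : sgraph U) (o' : U).
Variable F : {x | non_isolated g x} -> {y | non_isolated h y}.

(* [o'] is the default value at the isolated vertices of [g]. *)
Definition extend_isolated (x : T) : U :=
  if insub x is Some u then val (F u) else o'.

Lemma extend_isolatedE u : extend_isolated (val u) = val (F u).
Proof. by rewrite /extend_isolated valK. Qed.

Lemma extend_isolated_mono :
    (forall y, h o' y = false) ->
    (forall u v, delete_isolated h (F u) (F v) = delete_isolated g u v) ->
  {mono extend_isolated : x y / g x y >-> h x y}.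
Proof.
move=> isol' FM x y.
have isol z t : ~~ non_isolated g z ->
    (g z t = false) * (extend_isolated z = o').
  move=> nz; rewrite /extend_isolated insubN //; split=> //.
  by apply: contraNF nz => gzt; apply/existsP; exists t.
case: (boolP (non_isolated g x)) => [nx|nx]; last by rewrite !(isol x) ?isol'.
case: (boolP (non_isolated g y)) => [ny|ny]; last first.
  by rewrite adj_sym [RHS]adj_sym !(isol y) ?isol'.
rewrite -[x]/(val (exist (fun x => non_isolated g x) x nx)).
rewrite -[y]/(val (exist (fun x => non_isolated g x) y ny)) !extend_isolatedE.
exact: FM.
Qed.

End DeleteIsolated.

Lemma core_iso_delete_isolated (T U : finType) (g : sgraph T) (h : sgraph U)
    (o : T) (o' : U) :
  (forall y, g o y = false) -> (forall y, h o' y = false) ->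
  graph_iso (delete_isolated g) (delete_isolated h) ->
  exists f f', core_iso g h f f'.
Proof.
move=> isol isol' [F [F' FK F'K] FM].
exists (extend_isolated o' F), (extend_isolated o F'); split.
- exact: extend_isolated_mono.
- by apply: extend_isolated_mono => // u v; rewrite -FM !F'K.
- by move=> x y /non_isolated_ex[u ->]; rewrite !extend_isolatedE FK.
- by move=> x y /non_isolated_ex[u ->]; rewrite !extend_isolatedE F'K.
Qed.

(** * The graph of pairs *)

Section CycleOrder.

Variable gT : finGroupType.
Implicit Types a b c : gT.

Definition clt : rel gT := fun a b => <[a]> \proper <[b]>.
Definition above a : {set gT} := [set c | clt a c].
Definition below a : {set gT} := [set c | clt c a].

Lemma clt_trans : transitive clt.
Proof. by move=> b a c; apply: proper_trans. Qed.

Lemma cltxx a : clt a a = false.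
Proof. exact: properxx. Qed.

Lemma clt1 a : clt 1 a = (a != 1).
Proof. by rewrite /clt cycle1 proper1G cycle_eq1. Qed.

Lemma clt_neq1 a b : clt a b -> b != 1.
Proof.
by rewrite -clt1 /clt cycle1; apply: sub_proper_trans; apply: sub1G.
Qed.

Lemma cltn1 a : clt a 1 = false.
Proof. by apply/negP=> /clt_neq1/eqP. Qed.

End CycleOrder.

Definition swap (A B : Type) (x : A * B) : B * A := (x.2, x.1).

Section PairGraph.

Variables pT qT : finGroupType.
Implicit Types x y z : pT * qT.

Definition padj : rel (pT * qT) := fun x y =>
  clt x.1 y.1 && clt y.2 x.2 || clt y.1 x.1 && clt x.2 y.2.

(** Since [below c] is empty only for [c = 1], this says that [above x.1 * below x.2] is nonempty
    and [below x.1 * above x.2] is empty. The other side is the image under [swap]. *)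
Definition rside x : bool :=
  [&& x.2 != 1, above x.1 != set0 & (x.1 == 1) || (above x.2 == set0)].

Lemma padj_sym : symmetric padj.
Proof. by move=> x y; rewrite /padj orbC. Qed.

Lemma padj1 y : padj (1, 1) y = false.
Proof. by rewrite /padj /= !cltn1 andbF. Qed.

Lemma padj_axes a b : a != 1 -> b != 1 -> padj (1, b) (a, 1).
Proof. by move=> nt_a nt_b; rewrite /padj /= !clt1 nt_a nt_b. Qed.

Lemma padj_rside x y : rside x -> padj x y = clt x.1 y.1 && clt y.2 x.2.
Proof.
case/and3P=> _ _ /orP[/eqP a1|/eqP/setP/(_ y.2)]; rewrite /padj.
  by rewrite a1 cltn1 orbF.
by rewrite !inE => ->; rewrite andbF orbF.
Qed.

Lemma nbr_rside x : rside x -> nbr padj x = setX (above x.1) (below x.2).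
Proof. by move=> sx; apply/setP=> y; rewrite !inE padj_rside. Qed.

End PairGraph.

Lemma padj_swap (pT qT : finGroupType) :
  {mono @swap pT qT : x y / padj x y >-> padj x y}.
Proof. by move=> x y; rewrite /padj /= orbC; congr (_ || _); rewrite andbC. Qed.

Lemma core_iso_swap (pT qT : finGroupType) :
  core_iso (@padj pT qT) (@padj qT pT) (@swap _ _) (@swap _ _).
Proof. by split=> [||[]|[]] //; apply: padj_swap. Qed.

Lemma coconn_swap (pT qT : finGroupType) (x : pT * qT) :
  coconn (@padj pT qT) x -> coconn (@padj qT pT) (swap x).
Proof. exact: core_iso_coconn (@padj_sym _ _) (core_iso_swap _ _) _. Qed.

Lemma above1_neq0 (gT : finGroupType) :
  [set: gT] != 1 -> above (1 : gT) != set0.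
Proof.
by case/trivgPn=> a _ nt_a; apply/set0Pn; exists a; rewrite inE clt1.
Qed.

(** Pairs that agree in a coordinate are never adjacent, so [y], [(y.1, 1)], [(z.1, 1)], [z] is a
    path in the complement. *)
Lemma coconn_rside (pT qT : finGroupType) (x : pT * qT) :
  rside x -> coconn (@padj pT qT) x.
Proof.
move=> sx; have [nt_b /set0Pn[c]] := and3P sx; rewrite inE => lt_c _.
split=> [|y z]; first by exists (c, 1); rewrite padj_rside //= lt_c clt1.
rewrite !(padj_rside _ sx) => /andP[lt_y _] /andP[lt_z _].
exists (y.1, 1), (z.1, 1); rewrite !(padj_rside _ sx) /= lt_y lt_z !clt1 nt_b.
by split=> //; rewrite /padj /= !cltxx !andbF.
Qed.

(** * The two sides of the graph on the co-connected vertices *)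

Section Sides.

Variables pT qT : finGroupType.
Implicit Types x y z : pT * qT.

Lemma rside_axis b : [set: pT] != 1 -> b != 1 -> rside ((1, b) : pT * qT).
Proof. by move=> ntP nt_b; rewrite /rside /= nt_b above1_neq0 ?eqxx. Qed.

Lemma rside_disjoint x : rside x -> rside (swap x) = false.
Proof.
by case/and3P=> /= nt_b nea; rewrite /rside /= (negPf nt_b) (negPf nea) !andbF.
Qed.

(* Otherwise the neighbourhood of [(a, b)] is the join of
   [above a * below b] and [below a * above b], both of them nonempty. *)
Lemma coconn_sides x : coconn (@padj pT qT) x -> rside x || rside (swap x).
Proof.
case: x => a b [[y padj_y] ccx]; rewrite /swap /=.
case: (boolP (rside (a, b))) => // nsx; apply: contraT => nsx'.
have [nt_a nt_b /set0Pn[c +] /set0Pn[d +]]: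
    [/\ a != 1, b != 1, above a != set0 & above b != set0].
  case/orP: padj_y => /andP[/= lt1 lt2].
    have nea: above a != set0 by apply/set0Pn; exists y.1; rewrite inE.
    have nt_b := clt_neq1 lt2; move: nsx; rewrite /rside /= nt_b nea /=.
    by case/norP.
  have neb: above b != set0 by apply/set0Pn; exists y.2; rewrite inE.
  have nt_a := clt_neq1 lt1; move: nsx'; rewrite /rside /= nt_a neb /=.
  by case/norP.
rewrite !inE => lt_ac lt_bd.
have [||v [w [xv xw [cv vw wd]]]] := ccx (c, 1) (1, d).
- by rewrite /padj /= lt_ac clt1 nt_b.
- by rewrite /padj /= lt_bd clt1 nt_a orbT.
(* A step in the complement cannot leave the part [above a * below b], so a path from [(c, 1)] never
   reaches [(1, d)]. *)
have step u t : padj (a, b) t -> clt a u.1 -> clt u.2 b -> ~~ padj u t ->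
    clt a t.1 && clt t.2 b.
  case/orP=> // /andP[/= lt1 lt2] lt3 lt4 /negP[]; rewrite /padj.
  by rewrite (clt_trans lt1 lt3) (clt_trans lt4 lt2) orbT.
have /andP[lt_av lt_vb] := step (c, 1) v xv lt_ac (etrans (clt1 b) nt_b) cv.
have /andP[lt_aw lt_wb] := step _ _ xw lt_av lt_vb vw.
case/negP: wd; rewrite /padj /= clt1 (clt_neq1 lt_aw).
by rewrite (clt_trans lt_wb lt_bd) orbT.
Qed.

(** From [x.1 < v.1] and [v.2 < x.2] follow [v.1 <> 1] and [above v.2] nonempty, so [v] is not on
    the side of [x]. *)
Lemma rside_adj x v :
  rside x -> coconn (@padj pT qT) v -> padj x v -> rside (swap v).
Proof.
move=> sx /coconn_sides/orP[sv|//]; rewrite padj_rside // => /andP[lt1 lt2].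
case/and3P: sv => _ _ /orP[/eqP v1|/eqP/setP/(_ x.2)].
  by rewrite v1 cltn1 in lt1.
by rewrite !inE lt2.
Qed.

End Sides.

Section Path4.

Variables pT qT : finGroupType.
Implicit Types x y z : pT * qT.

(** Each of [x] and [y] has a neighbour [(c, 1)] with [c <> 1], and all of these are adjacent to
    [(1, x.2)]. *)
Lemma rside_path4 x y :
  [set: pT] != 1 -> [set: qT] != 1 ->
  rside x -> rside y -> coconn_path4 (@padj pT qT) x y.
Proof.
have ex z : rside z -> exists2 c, c != 1 & padj z (c, 1).
  move=> sz; have [nt_b /set0Pn[c]] := and3P sz; rewrite inE => lt_c _.
  by exists c; rewrite ?(clt_neq1 lt_c) // padj_rside //= lt_c clt1.
move=> ntP ntQ sx sy; have [c nt_c xc] := ex x sx; have [d nt_d yd] := ex y sy.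
have [nt_b _ _] := and3P sx; exists (c, 1), (1, x.2), (d, 1).
have cc_axis e : e != 1 -> coconn (@padj pT qT) (e, 1).
  move=> nt_e; apply: (@coconn_swap _ _ (1, e)).
  exact/coconn_rside/rside_axis.
split; try exact: cc_axis; first exact/coconn_rside/rside_axis.
by split; rewrite ?padj_axes //; rewrite padj_sym ?padj_axes.
Qed.

Lemma path4_rside x y :
  rside x -> coconn (@padj pT qT) y -> coconn_path4 (@padj pT qT) x y ->
  rside y.
Proof.
move=> sx ccy [v [w [u [ccv ccw ccu [xv vw wu uy]]]]].
have sv := rside_adj sx ccv xv.
have sw: rside w.
  by apply: (rside_adj sv (coconn_swap ccw)); rewrite padj_swap.
have su := rside_adj sw ccu wu.
by apply: (rside_adj su (coconn_swap ccy)); rewrite padj_swap.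
Qed.

End Path4.

(** * Isomorphisms preserving the sides *)

Definition side_iso (pT qT pT' qT' : finGroupType)
    (f : pT * qT -> pT' * qT') (f' : pT' * qT' -> pT * qT) : Prop :=
  [/\ core_iso (@padj pT qT) (@padj pT' qT') f f',
      forall x, rside x -> rside (f x) & forall y, rside y -> rside (f' y)].

Section SideIso.

Variables pT qT pT' qT' : finGroupType.
Hypotheses (ntP : [set: pT] != 1) (ntQ : [set: qT] != 1).
Hypotheses (ntP' : [set: pT'] != 1) (ntQ' : [set: qT'] != 1).
Variables (f : pT * qT -> pT' * qT') (f' : pT' * qT' -> pT * qT).

Lemma side_iso_sym : side_iso f f' -> side_iso f' f.
Proof. by case=> /core_iso_sym. Qed.

(** One vertex decides: the rest of its side is reached by walks that an isomorphism carries
    over. *)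
Lemma side_iso_base x :
  core_iso (@padj pT qT) (@padj pT' qT') f f' -> rside x -> rside (f x) ->
  side_iso f f'.
Proof.
move=> fP sx sfx; have fP' := core_iso_sym fP; have [fM f'M fK f'K] := fP.
split=> // y sy.
  apply: path4_rside sfx _ _.
    exact: (core_iso_coconn (@padj_sym _ _) fP (coconn_rside sy)).
  exact: (core_iso_path4 (@padj_sym _ _) fP (rside_path4 ntP ntQ sx sy)).
have xK: f' (f x) = x by have [[z xz] _] := coconn_rside sx; apply: fK xz.
apply: path4_rside sx _ _.
  exact: (core_iso_coconn (@padj_sym _ _) fP' (coconn_rside sy)).
rewrite -xK.
exact: (core_iso_path4 (@padj_sym _ _) fP' (rside_path4 ntP' ntQ' sfx sy)).
Qed.

(** This transfers results on the second factor to the first. If a vertex of the other side had its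
    image on the first side, [f'] would bring it back there, against disjointness. *)
Lemma side_iso_swap :
  side_iso f f' -> side_iso (@swap _ _ \o f \o @swap _ _)
                            (@swap _ _ \o f' \o @swap _ _).
Proof.
have half (pT1 qT1 pT2 qT2 : finGroupType) (e : pT1 * qT1 -> pT2 * qT2) e' x :
    side_iso e e' -> rside x -> rside (swap (e (swap x))).
  case=> eP eS e'S sx; have [eM _ eK _] := eP.
  have ccx := coconn_swap (coconn_rside sx).
  have /orP[] // := coconn_sides (core_iso_coconn (@padj_sym _ _) eP ccx).
  move/e'S; have [[z xz] _] := ccx; rewrite (eK _ _ xz) => /rside_disjoint.
  by rewrite [swap _](_ : _ = x) ?sx //; case: (x).
move=> fS; have [fP _ _] := fS; split=> [|x|x].
- exact (core_iso_comp (core_iso_swap qT pT)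
           (core_iso_comp fP (core_iso_swap pT' qT'))).
- exact: half fS.
- exact: half (side_iso_sym fS).
Qed.

End SideIso.

(** * Counting in abelian p-groups *)

Section AbelianPgroup.

Variables (gT : finGroupType) (p : nat).
Hypotheses (p_pr : prime p) (pG : p.-group [set: gT]).
Hypothesis cGG : abelian [set: gT].
Implicit Types a b c : gT.

Lemma p_elt_all a : p.-elt a.
Proof. exact: mem_p_elt pG (in_setT a). Qed.

Lemma p_dvd_order a : a != 1 -> p %| #[a].
Proof.
rewrite -order_gt1; have /p_natP[[|n] ->] // := p_elt_all a.
by rewrite expnS dvdn_mulr.
Qed.

(** The subgroups of a cyclic p-group form a chain, in which [<[a ^+ p]>] is the largest proper
    one. *)
Lemma belowE a : a != 1 -> below a = <[a ^+ p]>.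
Proof.
move=> nt_a; have p_a := p_dvd_order nt_a; apply/setP=> c; rewrite inE.
have oap := orderXdiv p_a.
apply/idP/idP=> [lt_ca | ap_c].
  have sca := proper_sub lt_ca.
  rewrite -cycle_subG -(cardSg_cyclic (cycle_cyclic a)) ?cycleX //.
  rewrite -!orderE oap.
  have := proper_card lt_ca; rewrite -!orderE.
  have /p_natP[m ->] := p_elt_all c; have /p_natP[[|n] ->] := p_elt_all a.
    by rewrite ltnNge expn_gt0 prime_gt0.
  rewrite ltn_exp2l ?prime_gt1 // expnSr mulnK ?prime_gt0 //.
  by rewrite ltnS => /dvdn_exp2l->.
apply: (sub_proper_trans (B := <[a ^+ p]>)); first by rewrite cycle_subG.
rewrite properEcard cycleX -!orderE oap /= ltn_Pdiv ?prime_gt1 //.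
Qed.

Lemma card_below a : a != 1 -> (#|below a| * p = #[a])%N.
Proof.
move=> nt_a; rewrite belowE // -orderE orderXdiv ?p_dvd_order //.
by rewrite divnK ?p_dvd_order.
Qed.

Lemma exists_order_p : [set: gT] != 1 -> exists z : gT, #[z] = p.
Proof.
move=> ntG; have [_ p_dvd _] := pgroup_pdiv pG ntG.
by have [z _ oz] := Cauchy p_pr p_dvd; exists z.
Qed.

(** The p-group [<[z]>] acts on [S] by right translation without fixed points. *)
Lemma dvdn_card_translate (S : {set gT}) z :
  #[z] = p -> (forall x, x \in S -> x * z \in S) -> p %| #|S|.
Proof.
move=> oz Sz.
have actS: [acts <[z]>, on S | 'R].
  rewrite cycle_subG !inE /=; apply/subsetP=> x Sx; rewrite !inE; exact: Sz.
have := pgroup_fix_mod (mem_p_elt pG (in_setT z)) actS.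
suffices ->: 'Fix_(S | 'R)(<[z]>) = set0 by rewrite cards0 mod0n => /eqP.
apply/setP=> x; rewrite !inE; apply/negP=> /andP[_ /subsetP/(_ z (cycle_id z))].
rewrite !inE /= -{2}[x]mulg1 (inj_eq (mulgI x)) => /eqP z1.
by have := prime_gt1 p_pr; rewrite -oz z1 order1.
Qed.

Lemma expMgp a b : (a * b) ^+ p = a ^+ p * b ^+ p.
Proof. by apply: expgMn; apply: (centsP cGG); rewrite inE. Qed.

(** Whether [c] lies above [a] depends only on [c ^+ p], which does not change when [c] is
    multiplied by an element of order [p]. *)
Lemma dvdn_above a : a != 1 -> p %| #|above a|.
Proof.
move=> nt_a; have [|z oz] := exists_order_p.
  by apply/trivgPn; exists a.
apply: (dvdn_card_translate oz) => c; rewrite !inE => lt_ac.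
have zp: z ^+ p = 1 by rewrite -oz expg_order.
have: a \in below c by rewrite inE.
rewrite belowE ?(clt_neq1 lt_ac) // => cp_a.
suffices: a \in below (c * z) by rewrite inE.
rewrite belowE ?expMgp ?zp ?mulg1 //; apply: contraNneq nt_a => cz1.
have := expMgp c z; rewrite cz1 expg1n zp mulg1 => cp.
by move: cp_a; rewrite -cp cycle1 inE.
Qed.

Lemma card_LdivpT : [set: gT] != 1 ->
  exists n, #|'Ldiv_p([set: gT])| = (p ^ n.+1)%N.
Proof.
move=> ntG; have := OhmEabelian pG (abelianS (Ohm_sub 1 _) cGG).
rewrite expn1 => <-.
have /p_natP[[|n] on] := pgroupS (Ohm_sub 1 _) pG; last by exists n.
by case/eqP: (ntG); apply/eqP; rewrite -Ohm1_eq1 trivg_card1 on.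
Qed.

Lemma below_twins_p b :
  b != 1 -> b ^+ p = 1 ->
  [set c | below c == below b] = 'Ldiv_p([set: gT]) :\ 1.
Proof.
move=> nt_b bp; apply/setP=> c; rewrite !inE (belowE nt_b) bp cycle1.
have [->|nt_c] := eqVneq c 1; last by rewrite belowE // cycle_eq1.
by apply/negP=> /eqP/setP/(_ 1); rewrite !inE cltxx eqxx.
Qed.

(** The condition on [c] says that [c ^+ p] generates [<[b ^+ p]>]. The p-th power map is a
    homomorphism, whose fibre over each such generator is a coset of the p-torsion. *)
Lemma card_below_twins b : b ^+ p != 1 ->
  #|[set c | below c == below b]|
    = (#|'Ldiv_p([set: gT])| * totient #[b ^+ p])%N.
Proof.
move=> nt_bp; have nt_b: b != 1.
  by apply: contraNneq nt_bp => ->; rewrite expg1n.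
rewrite totient_gen; set S := [set c | _]; set R := [set x | _].
have SR c : (c \in S) = (c ^+ p \in R).
  rewrite !inE (belowE nt_b) /generator.
  have [->|nt_c] := eqVneq c 1; last by rewrite belowE // eq_sym.
  rewrite expg1n cycle1 cycle_eq1 (negPf nt_bp).
  by apply/negP=> /eqP/setP/(_ 1); rewrite inE cltxx group1.
rewrite -sum1_card (partition_big (fun c => c ^+ p) (mem R)) /=; last first.
  by move=> c; rewrite SR.
set k := #|'Ldiv_p(_)|.
rewrite (eq_bigr (fun _ => k)) ?sum_nat_const 1?mulnC // => r.
rewrite inE /generator => /eqP def_r.
have /cycleP[n def_n]: r \in <[b ^+ p]> by rewrite def_r cycle_id.
(* A p-th root of [r]: the fibre over [r] is the coset through [s]. *)
pose s := b ^+ n; have sp: s ^+ p = r by rewrite def_n -!expgM mulnC.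
rewrite /k -(card_imset _ (mulgI s)) -sum1_card; apply: eq_bigl => c.
rewrite SR andbC; case: eqP => [cp|ncp] /=; last first.
  apply/esym/imsetP=> -[z]; rewrite !inE => /eqP zp def_c.
  by case: ncp; rewrite def_c expMgp zp mulg1.
rewrite cp inE /generator def_r eqxx.
apply/esym/imsetP; exists (s^-1 * c); last by rewrite mulKVg.
by rewrite !inE expMgp expgVn sp cp mulVg eqxx.
Qed.

End AbelianPgroup.

Record abelian_pgroup_type (p : nat) (gT : finGroupType) : Prop := {
  ap_prime : prime p;
  ap_pgroup : p.-group [set: gT];
  ap_abelian : abelian [set: gT];
  ap_nontrivial : [set: gT] != 1
}.

Lemma count_mem_pfactor p k (s : seq nat) :
  prime p -> all (pnat p) s ->
  (count_mem (p ^ k.+1)%N s + count [pred m | k.+1 < logn p m] s)%N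
    = count [pred m | k < logn p m] s.
Proof.
move=> p_pr; elim: s => //= _ s IHs /andP[/p_natP[j ->] /IHs <-].
rewrite !pfactorK // (inj_eq (expnI (prime_gt1 p_pr))) addnACA; congr addn.
by rewrite eq_sym; case: ltngtP.
Qed.

(** The solutions of [x ^+ (p ^ n) = 1] form ['Ohm_n], and the index of ['Ohm_n] in ['Ohm_n.+1] is
    [p] to the number of cyclic factors of order greater than [p ^ n]. These numbers determine the
    abelian type. *)
Lemma isog_abelian_pgroup p (gT kT : finGroupType)
    (G : {group gT}) (K : {group kT}) :
    prime p -> p.-group G -> p.-group K -> abelian G -> abelian K ->
    (forall n, #|'Ldiv_(p ^ n)(G)| = #|'Ldiv_(p ^ n)(K)|) ->
  G \isog K.
Proof.
move=> p_pr pG pK cGG cKK eqL.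
have eqO n : #|'Ohm_n(G)| = #|'Ohm_n(K)|.
  have [cOG cOK] := (abelianS (Ohm_sub n G) cGG, abelianS (Ohm_sub n K) cKK).
  by rewrite (OhmEabelian pG cOG) (OhmEabelian pK cOK).
have eq_count n : count [pred m | n < logn p m] (abelian_type G)
                = count [pred m | n < logn p m] (abelian_type K).
  have [b defG <-] := abelian_structure cGG.
  have [d defK <-] := abelian_structure cKK.
  rewrite !count_map.
  rewrite (count_logn_dprod_cycle p n defG) (count_logn_dprod_cycle p n defK).
  by rewrite -!divgS ?Ohm_leq // !eqO.
have p_type (hT : finGroupType) (H : {group hT}) :
    p.-group H -> abelian H -> all (pnat p) (abelian_type H).
  move=> pH cHH; have [b defH <-] := abelian_structure cHH.
  apply/allP=> _ /mapP[x b_x ->]; apply: mem_p_elt pH _.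
  rewrite -cycle_subG -(bigdprodWY defH) ?sub_gen //.
  by rewrite bigcup_seq (bigcup_sup x).
have [ptG ptK] := (p_type _ _ pG cGG, p_type _ _ pK cKK).
rewrite eq_abelian_type_isog //; apply/eqP.
(* Both types are sorted, so equal multiplicities suffice; as entries exceed 1, only values
   [p ^ k.+1] occur. *)
apply: (sorted_eq (leT := geq)); try exact: abelian_type_sorted.
- by move=> m n k /= le_mn le_km; apply: leq_trans le_mn.
- by move=> m n /=; rewrite andbC -eqn_leq => /eqP.
apply/allP=> m; rewrite mem_cat => m_in.
have pm: p.-nat m by case/orP: m_in; [move/(allP ptG) | move/(allP ptK)].
have m_gt1: 1 < m.
  by case/orP: m_in; apply: (allP (abelian_type_gt1 _)).
have [k def_m] := p_natP pm.
case: k def_m => [|k] def_m; first by rewrite def_m in m_gt1.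
have := count_mem_pfactor k p_pr ptG.
rewrite !eq_count -(count_mem_pfactor k p_pr ptK) -def_m.
by move/addIn=> /= ->.
Qed.

(** * Recovering the Sylow subgroups *)

Section PairOfPgroups.

Variables (pT qT : finGroupType) (q : nat).
Hypotheses (ntP : [set: pT] != 1).
Hypotheses (q_pr : prime q) (qQ : q.-group [set: qT]) (cQQ : abelian [set: qT]).
Implicit Types (x y z : pT * qT) (a : pT) (b c d : qT).

Lemma card_nbr_rside x :
  rside x -> #|nbr (@padj pT qT) x| = (#|above x.1| * #|below x.2|)%N.
Proof. by move=> sx; rewrite nbr_rside // cardsX. Qed.

Lemma card_below_gt0 b : b != 1 -> 0 < #|below b|.
Proof. by move=> nt_b; apply/card_gt0P; exists 1; rewrite inE clt1. Qed.

Lemma card_above1 (gT : finGroupType) : #|above (1 : gT)| = #|[set: gT]|.-1.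
Proof.
rewrite [in RHS](cardsD1 1) inE add1n; apply: eq_card => c.
by rewrite !inE clt1 andbT.
Qed.

Lemma card_above_lt a : a != 1 -> #|above a| < #|above (1 : pT)|.
Proof.
move=> nt_a; apply/proper_card/properP; split.
  by apply/subsetP=> c; rewrite !inE clt1 => /clt_neq1.
by exists a; rewrite inE ?clt1 ?cltxx.
Qed.

Lemma card_twins_axis b : b != 1 ->
  #|twins (@padj pT qT) (1, b)| = #|[set c | below c == below b]|.
Proof.
move=> nt_b; rewrite -[RHS]mul1n -(cards1 (1 : pT)) -cardsX.
have [a _ nt_a] := trivgPn _ ntP.
apply: eq_card => -[a' b']; rewrite !inE.
apply/eqP/andP=> /= [eq_nbr | [/eqP-> /eqP eq_below]]; last first.
  have nt_b': b' != 1.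
    have: 1 \in below b by rewrite inE clt1.
    by rewrite -eq_below inE => /clt_neq1.
  by rewrite !nbr_rside ?rside_axis //= eq_below.
have eq_padj y : padj (a', b') y = padj (1, b) y.
  by have /setP/(_ y) := eq_nbr; rewrite !inE.
have a'1: a' = 1.
  (* The vertex [(a', 1)] is adjacent to [(1, b)], but agrees with [(a', b')] in a coordinate. *)
  apply/eqP; apply: contraT => nt_a'; have := eq_padj (a', 1).
  by rewrite padj_axes // /padj /= !cltxx.
have nt_b': b' != 1.
  apply/eqP=> b'1; have := eq_padj (a, 1).
  by rewrite padj_axes // a'1 b'1 padj1.
split; apply/eqP=> //; apply/setP=> d; have := eq_padj (a, d).
by rewrite a'1 !padj_rside ?rside_axis //= !inE clt1 nt_a.
Qed.

(** The degree is a product, and replacing [a <> 1] by [1] strictly enlarges its factor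
    [#|above a|]. *)
Lemma degmax_axis y : rside y ->
    (forall x, rside x -> #|nbr (@padj pT qT) x| <= #|nbr (@padj pT qT) y|) ->
  y.1 = 1 /\ forall d, d != 1 -> #|below d| <= #|below y.2|.
Proof.
move=> sy max_y; have [nt_b _ _] := and3P sy.
have y1: y.1 = 1.
  apply/eqP; apply: contraTT (max_y _ (rside_axis ntP nt_b)) => nt_a.
  rewrite -ltnNge !card_nbr_rside ?rside_axis // ltn_pmul2r ?card_below_gt0 //.
  exact: card_above_lt.
split=> // d nt_d; have := max_y _ (rside_axis ntP nt_d).
rewrite !card_nbr_rside ?rside_axis //= y1 leq_pmul2l //.
by rewrite card_gt0 above1_neq0.
Qed.

(** The cases are [y.2 ^+ q = 1], where maximality forces exponent [q], and [y.2 ^+ q <> 1]. Their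
    last clauses contradict each other, so the graph tells which one holds. *)
Lemma degmax_twins y : rside y ->
    (forall x, rside x -> #|nbr (@padj pT qT) x| <= #|nbr (@padj pT qT) y|) ->
  let tw x := #|twins (@padj pT qT) x| in
     [/\ tw y = #|[set: qT]|.-1 & forall x, rside x -> tw y <= tw x]
  \/ [/\ q %| tw y, forall r, prime r -> r %| tw y -> r <= q
       & exists2 x, rside x & tw x < tw y].
Proof.
move=> sy max_y tw; have [y1 max_below] := degmax_axis sy max_y.
have [nt_b _ _] := and3P sy; case: y => a b /= in y1 max_below sy max_y nt_b *.
have ntQ: [set: qT] != 1 by apply/trivgPn; exists b.
rewrite {}y1 /tw card_twins_axis // {max_y}.
have [bq | nt_bq] := eqVneq (b ^+ q) 1; [left | right].
  have expQ d : d ^+ q = 1.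
    have [->|nt_d] := eqVneq d 1; first exact: expg1n.
    have := max_below d nt_d; rewrite !(belowE q_pr qQ) // bq cycle1 cards1.
    by rewrite -trivg_card_le1 cycle_eq1 => /eqP.
  rewrite (below_twins_p q_pr qQ nt_b bq).
  have ->: 'Ldiv_q([set: qT]) :\ 1 = [set d | d != 1].
    by apply/setP=> d; rewrite !inE expQ eqxx !andbT.
  split; first by rewrite -card_above1; apply: eq_card => d; rewrite !inE clt1.
  case=> a' b' sx; have [nt_b' _ _] := and3P sx.
  rewrite -[X in X <= _]mul1n -(cards1 a') -cardsX.
  (* In exponent [q], [above d] is empty and [below d] trivial for [d <> 1], so all these [(a', d)]
     are twins of [(a', b')]. *)
  have rs d : d != 1 -> rside (a', d).
    move=> nt_d; move: sx; rewrite /rside nt_b' nt_d /=.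
    suffices ->: above d = above b' by [].
    apply/setP=> c; rewrite !inE.
    have abv e : e != 1 -> clt e c = false.
      move=> nt_e; apply/negP=> lt_ec; have: e \in below c by rewrite inE.
      rewrite (belowE q_pr qQ) ?(clt_neq1 lt_ec) // expQ cycle1 inE.
      by rewrite (negPf nt_e).
    by rewrite !abv.
  apply/subset_leq_card/subsetP=> -[a'' d].
  rewrite !inE /= => /andP[/eqP-> nt_d].
  by rewrite !nbr_rside ?rs //= !(belowE q_pr qQ) // !expQ.
have [n oO] := card_LdivpT qQ cQQ ntQ.
have oT := card_below_twins q_pr qQ cQQ nt_bq.
have /p_natP[[|k] obq] := p_elt_all qQ (b ^+ q).
  by case/eqP: nt_bq; apply/eqP; rewrite -order_eq1 obq.
split; first by rewrite oT oO expnS -mulnA dvdn_mulr.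
  move=> r r_pr; rewrite oT oO obq totient_pfactor // !Euclid_dvdM //.
  have le_q: r %| q -> r <= q by apply: dvdn_leq; rewrite prime_gt0.
  case/or3P; rewrite ?Euclid_dvdX //; try by case/andP=> /le_q.
  move=> r_dvd; apply: leq_trans (leq_pred q); apply: dvdn_leq r_dvd.
  by rewrite -ltnS prednK ?prime_gt1 ?prime_gt0.
have [z oz] := exists_order_p q_pr qQ ntQ.
have nt_z: z != 1 by rewrite -order_gt1 oz prime_gt1.
have zq: z ^+ q = 1 by rewrite -oz expg_order.
exists (1, z); first exact: rside_axis.
rewrite card_twins_axis // (below_twins_p q_pr qQ nt_z zq) oT.
have O1: 1 \in 'Ldiv_q([set: qT]) by rewrite !inE expg1n eqxx.
rewrite [in X in _ < X](cardsD1 1) O1 add1n.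
by rewrite leq_pmulr // totient_gt0 order_gt0.
Qed.

(** For [x.1 = 1] the factors of the degree are the order of the first group minus 1, which is -1
    modulo [p], and a power of [q]. *)
Lemma rside_axis_dvdn p x :
    prime p -> p.-group [set: pT] -> abelian [set: pT] -> p != q ->
  rside x -> (x.1 == 1) = ~~ (p %| #|nbr (@padj pT qT) x|).
Proof.
move=> p_pr pP cPP neq_pq sx; have [nt_b _ _] := and3P sx.
rewrite card_nbr_rside // Euclid_dvdM //.
have [-> | nt_a] := eqVneq x.1 1; last by rewrite (dvdn_above p_pr pP cPP).
apply/esym/norP; split; last first.
  have /p_natP[n obq] := p_elt_all qQ (x.2).
  apply: contra neq_pq => p_dvd.
  have: p %| #[x.2] by rewrite -(card_below q_pr qQ nt_b) dvdn_mulr.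
  by rewrite obq Euclid_dvdX // dvdn_prime2 // => /andP[].
have [_ p_dvd _] := pgroup_pdiv pP ntP.
apply/negP; rewrite card_above1 => p_dvd1.
have := dvdn_sub p_dvd p_dvd1.
rewrite -subn1 subKn ?cardG_gt0 // dvdn1 => /eqP p1.
by rewrite p1 in p_pr.
Qed.

End PairOfPgroups.

(** * Invariance of the primes *)

Section SideIsoPrime.

Variables (pT qT pT' qT' : finGroupType) (q q' : nat).
Hypotheses (ntP : [set: pT] != 1) (ntP' : [set: pT'] != 1).
Hypotheses (apQ : abelian_pgroup_type q qT) (apQ' : abelian_pgroup_type q' qT').
Variables (f : pT * qT -> pT' * qT') (f' : pT' * qT' -> pT * qT).
Hypothesis fS : side_iso f f'.

Lemma side_iso_card_nbr x :
  #|nbr (@padj pT' qT') (f x)| = #|nbr (@padj pT qT) x|.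
Proof.
have [fP _ _] := fS.
by apply: core_iso_card_nbr fP _; apply: padj_sym.
Qed.

Lemma side_iso_card_twins x : rside x ->
  #|twins (@padj pT' qT') (f x)| = #|twins (@padj pT qT) x|.
Proof.
have [fP _ _] := fS; case/coconn_rside=> -[y xy] _.
by apply: core_iso_twins fP _ _ xy; apply: padj_sym.
Qed.

Lemma side_isoK x : rside x -> f' (f x) = x.
Proof. by have [[_ _ fK _] _ _] := fS; case/coconn_rside=> -[y /fK]. Qed.

(** A vertex of maximal degree and its image fall under the same case of [degmax_twins]. In the
    first the groups have equal orders; in the second [q] and [q'] are the largest prime divisor of
    the same number. *)
Lemma side_iso_prime : q = q'.
Proof.
have [q_pr qQ cQQ ntQ] := apQ; have [q'_pr qQ' cQQ' ntQ'] := apQ'.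
have [fP fR f'R] := fS.
have [b _ nt_b] := trivgPn _ ntQ.
case: (@arg_maxnP _ (1, b) (@rside pT qT) (fun x => #|nbr (@padj pT qT) x|)).
  exact: rside_axis.
move=> y sy max_y.
have max_fy x : rside x ->
    #|nbr (@padj pT' qT') x| <= #|nbr (@padj pT' qT') (f y)|.
  move=> sx; rewrite side_iso_card_nbr; have [_ _ _ f'K] := fP.
  have [[z xz] _] := coconn_rside sx.
  by rewrite -(f'K x z xz) side_iso_card_nbr; apply/max_y/f'R.
have tw_f' x : rside x ->
    #|twins (@padj pT' qT') x| = #|twins (@padj pT qT) (f' x)|.
  move=> sx; have [_ _ _ f'K] := fP; have [[z xz] _] := coconn_rside sx.
  by rewrite -{1}(f'K x z xz) side_iso_card_twins ?f'R.
have := degmax_twins ntP' q'_pr qQ' cQQ' (fR y sy) max_fy.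
have := degmax_twins ntP q_pr qQ cQQ sy max_y.
rewrite /= !(side_iso_card_twins sy).
case=> [[-> min_y] | [q_dvd q_max [x sx lt_x]]].
  case=> [[eq_card _] | [_ _ [x sx]]]; last first.
    by rewrite tw_f' // ltnNge min_y ?f'R.
  have [_ q_dvd _] := pgroup_pdiv qQ ntQ.
  have oQ: #|[set: qT]| = #|[set: qT']|.
    by rewrite -(prednK (cardG_gt0 [set: qT])) eq_card prednK ?cardG_gt0.
  have /p_natP[n oQ'] := qQ'.
  move: q_dvd; rewrite oQ oQ' Euclid_dvdX // dvdn_prime2 // => /andP[/eqP //].
case=> [[_ min_fy] | [q'_dvd q'_max _]].
  by move: (min_fy _ (fR x sx)); rewrite side_iso_card_twins // leqNgt lt_x.
by apply/eqP; rewrite eqn_leq q_max // q'_max.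
Qed.

End SideIsoPrime.

(** * Invariance of the element orders *)

Section SideIsoOrder.

Variables (pT qT pT' qT' : finGroupType) (p q : nat).
Hypotheses (apP : abelian_pgroup_type p pT) (apP' : abelian_pgroup_type p pT').
Hypotheses (apQ : abelian_pgroup_type q qT) (apQ' : abelian_pgroup_type q qT').
Hypothesis neq_pq : p != q.
Variables (f : pT * qT -> pT' * qT') (f' : pT' * qT' -> pT * qT).
Hypothesis fS : side_iso f f'.

Let g b := (f (1, b)).2.

Lemma side_iso_axis b : b != 1 -> f (1, b) = (1, g b) /\ g b != 1.
Proof.
have [p_pr pP cPP ntP] := apP; have [_ pP' cPP' ntP'] := apP'.
have [q_pr qQ _ _] := apQ; have [_ qQ' _ _] := apQ'.
move=> nt_b; have [fP fR _] := fS.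
have sb := rside_axis ntP nt_b; have sfb := fR _ sb.
have := rside_axis_dvdn ntP' q_pr qQ' p_pr pP' cPP' neq_pq sfb.
rewrite (side_iso_card_nbr fS).
rewrite -(rside_axis_dvdn ntP q_pr qQ p_pr pP cPP neq_pq sb) eqxx => /eqP f1.
by split; [rewrite /g -f1 -surjective_pairing | case/and3P: sfb].
Qed.

(** Off the identity [g] inherits injectivity from [f]; at the isolated vertex [(1, 1)] nothing is
    known about [f]. *)
Lemma side_iso_leq_card (S : {set qT}) (S' : {set qT'}) :
  1 \notin S -> (forall b, b \in S -> g b \in S') -> #|S| <= #|S'|.
Proof.
move=> S1 gS; have nt b : b \in S -> b != 1 by apply: contraTneq => ->.
rewrite -(card_in_imset (f := g) (D := mem S)).
  by apply/subset_leq_card/subsetP=> _ /imsetP[b Sb ->]; apply: gS.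
move=> b c /nt nt_b /nt nt_c eq_g.
have [fK ntP] := (side_isoK fS, ap_nontrivial apP).
have: (1, b) = (1, c) :> pT * qT; last by case.
rewrite -(fK (1, b)) ?rside_axis // -(fK (1, c)) ?rside_axis //.
by rewrite (side_iso_axis nt_b).1 (side_iso_axis nt_c).1 eq_g.
Qed.

Lemma side_iso_leq_cardT : #|[set: qT]| <= #|[set: qT']|.
Proof.
rewrite (cardsD1 1) (cardsD1 1 [set: qT']) !inE leq_add2l.
apply: side_iso_leq_card => [|b]; rewrite !inE ?eqxx // !andbT => nt_b.
by case: (side_iso_axis nt_b).
Qed.

Lemma side_iso_order b : #|[set: pT]| = #|[set: pT']| -> b != 1 ->
  #[g b] = #[b].
Proof.
have [q_pr qQ _ _] := apQ; have [_ qQ' _ _] := apQ'.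
have [ntP ntP'] := (ap_nontrivial apP, ap_nontrivial apP').
move=> oP nt_b; have [fb nt_gb] := side_iso_axis nt_b.
have := side_iso_card_nbr fS (1, b); rewrite fb.
rewrite !card_nbr_rside ?rside_axis //= !card_above1 oP => /eqP.
rewrite eqn_pmul2l => [/eqP eq_below|]; last first.
  by rewrite -card_above1 card_gt0 above1_neq0.
by rewrite -(card_below q_pr qQ' nt_gb) eq_below (card_below q_pr qQ nt_b).
Qed.

Lemma side_iso_leq_Ldiv n : #|[set: pT]| = #|[set: pT']| ->
  #|'Ldiv_n([set: qT])| <= #|'Ldiv_n([set: qT'])|.
Proof.
have L1 (hT : finGroupType) : 1 \in 'Ldiv_n([set: hT]).
  by rewrite !inE expg1n eqxx.
move=> oP; rewrite (cardsD1 1) (cardsD1 1 'Ldiv_n([set: qT'])) !L1 leq_add2l.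
apply: side_iso_leq_card => [|b]; rewrite !inE ?eqxx //= => /andP[nt_b].
have [_ ->] := side_iso_axis nt_b.
by rewrite -!order_dvdn side_iso_order.
Qed.

End SideIsoOrder.

Lemma side_iso_isog (pT qT pT' qT' : finGroupType) (p q p' q' : nat)
    (f : pT * qT -> pT' * qT') (f' : pT' * qT' -> pT * qT) :
    abelian_pgroup_type p pT -> abelian_pgroup_type q qT -> p != q ->
    abelian_pgroup_type p' pT' -> abelian_pgroup_type q' qT' ->
    side_iso f f' ->
  [set: pT] \isog [set: pT'] /\ [set: qT] \isog [set: qT'].
Proof.
move=> apP apQ neq_pq apP' apQ' fS; have fS' := side_iso_swap fS.
have [p_pr pP cPP ntP] := apP; have [q_pr qQ cQQ ntQ] := apQ.
have [_ pP' cPP' ntP'] := apP'; have [_ qQ' cQQ' ntQ'] := apQ'.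
have eq_q := side_iso_prime ntP ntP' apQ apQ' fS.
have eq_p := side_iso_prime ntQ ntQ' apP apP' fS'.
rewrite -{}eq_p -{}eq_q in pP' qQ' apP' apQ'.
have neq_qp: q != p by rewrite eq_sym.
have [gS gS'] := (side_iso_sym fS, side_iso_sym fS').
(* Group orders come first: degrees give the element orders in one factor once the order of the
   other is known to be preserved. *)
have oQ: #|[set: qT]| = #|[set: qT']|.
  apply/eqP; rewrite eqn_leq (side_iso_leq_cardT apP apP' apQ apQ' neq_pq fS).
  exact: (side_iso_leq_cardT apP' apP apQ' apQ neq_pq gS).
have oP: #|[set: pT]| = #|[set: pT']|.
  apply/eqP; rewrite eqn_leq (side_iso_leq_cardT apQ apQ' apP apP' neq_qp fS').
  exact: (side_iso_leq_cardT apQ' apQ apP' apP neq_qp gS').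
split.
  apply: (isog_abelian_pgroup p_pr) => // n; apply/eqP; rewrite eqn_leq.
  rewrite (side_iso_leq_Ldiv apQ apQ' apP apP' neq_qp fS') //.
  exact: (side_iso_leq_Ldiv apQ' apQ apP' apP neq_qp gS').
apply: (isog_abelian_pgroup q_pr) => // n; apply/eqP; rewrite eqn_leq.
rewrite (side_iso_leq_Ldiv apP apP' apQ apQ' neq_pq fS) //.
exact: (side_iso_leq_Ldiv apP' apP apQ' apQ neq_pq gS).
Qed.

(** * The difference graph as a graph of pairs *)

Lemma clt_sgval (gT : finGroupType) (G : {group gT}) (u v : subg_of G) :
  clt (sgval u) (sgval v) = clt u v.
Proof.
have cyc w : <[sgval w]> = sgval @* <[w : subg_of G]>.
  by rewrite morphim_cycle ?inE.
rewrite /clt !cyc (injm_proper (injm_sgval G)) //; exact: subsetT.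
Qed.

Lemma mem_cycle_constt (gT : finGroupType) (pi : nat_pred) (x y : gT) :
  (x \in <[y]>) =
    (<[x.`_pi]> \subset <[y.`_pi]>) && (<[x.`_pi^']> \subset <[y.`_pi^']>).
Proof.
rewrite !cycle_subG; apply/idP/andP=> [/cycleP[n ->] | [xp xp']].
  by rewrite !consttX !mem_cycle.
have sub rho : <[y.`_rho]> \subset <[y]> by rewrite cycle_subG mem_cycle.
rewrite -(consttC pi x) groupM //; first exact: (subsetP (sub _) _ xp).
exact: (subsetP (sub _) _ xp').
Qed.

(** Inclusion of subgroups of a cyclic group is divisibility of their orders, here powers of [p]. *)
Lemma p_elt_cycle_total (gT : finGroupType) (p : nat) (a c z : gT) :
  p.-elt a -> p.-elt c -> a \in <[z]> -> c \in <[z]> ->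
  (<[a]> \subset <[c]>) || (<[c]> \subset <[a]>).
Proof.
move=> p_a p_c za zc.
have subE b d : b \in <[z]> -> d \in <[z]> ->
    (<[b]> \subset <[d]>) = (#[b] %| #[d]).
  by move=> zb zd; rewrite -(cardSg_cyclic (cycle_cyclic z)) ?cycle_subG.
rewrite !subE //.
have [/p_natP[m ->] /p_natP[n ->]] := (p_a, p_c).
by case: (leqP m n) => [|/ltnW] /dvdn_exp2l->; rewrite ?orbT.
Qed.

Section DifferencePairs.

Variables (gT : finGroupType) (p q : nat).
Hypothesis cGG : abelian [set: gT].
Hypothesis pi_q : forall x : gT, q.-elt x.`_p^'.
Implicit Types x y : gT.

(** If the parts are comparable, the product [u * w] of the larger p-part and the larger p'-part
    generates a cyclic group containing [x] and [y]. *)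
Lemma cyclic_gen2 x y : cyclic <<[set x; y]>> =
  ((<[x.`_p]> \subset <[y.`_p]>) || (<[y.`_p]> \subset <[x.`_p]>)) &&
  ((<[x.`_p^']> \subset <[y.`_p^']>) || (<[y.`_p^']> \subset <[x.`_p^']>)).
Proof.
apply/idP/andP=> [/cyclicP[z def_z] | [cmp_p cmp_q]].
  have zz t rho : t \in [set x; y] -> t.`_rho \in <[z]>.
    by move=> tS; rewrite -def_z groupX // mem_gen.
  have [xS yS]: x \in [set x; y] /\ y \in [set x; y] by rewrite !inE !eqxx orbT.
  split; first by apply: p_elt_cycle_total (zz _ _ xS) (zz _ _ yS);
                  apply: p_elt_constt.
  exact: p_elt_cycle_total (pi_q x) (pi_q y) (zz _ _ xS) (zz _ _ yS).
have top (a c : gT) : (<[a]> \subset <[c]>) || (<[c]> \subset <[a]>) ->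
    exists2 u, u \in [set a; c]
             & (<[a]> \subset <[u]>) && (<[c]> \subset <[u]>).
  by case/orP=> s; [exists c | exists a]; rewrite ?inE ?eqxx ?orbT ?s ?subxx.
have [u u_in /andP[xu yu]] := top _ _ cmp_p.
have [w w_in /andP[xw yw]] := top _ _ cmp_q.
have p_u: p.-elt u.
  by move: u_in; rewrite !inE => /orP[]/eqP->; apply: p_elt_constt.
have p_w: p^'.-elt w.
  by move: w_in; rewrite !inE => /orP[]/eqP->; apply: p_elt_constt.
have cuw: commute u w by apply: (centsP cGG); rewrite inE.
have up: (u * w).`_p = u.
  by rewrite consttM // (constt_p_elt p_u) (constt1P p_w) mulg1.
have wp: (u * w).`_p^' = w.
  have /constt1P u1: (p^')^'.-elt u by rewrite /p_elt pnatNK.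
  by rewrite consttM // (constt_p_elt p_w) u1 mul1g.
apply: (cyclicS (G := <[u * w]>)); last exact: cycle_cyclic.
rewrite gen_subG; apply/subsetP=> t; rewrite !inE => /orP[]/eqP->.
  by rewrite (mem_cycle_constt p) up wp xu.
by rewrite (mem_cycle_constt p) up wp yu.
Qed.

Let P := 'O_p([set: gT])%G.
Let Q := 'O_p^'([set: gT])%G.

Lemma nil_abelianT : nilpotent [set: gT].
Proof. exact: abelian_nil. Qed.

Lemma mem_pcoreT pi x : (x \in 'O_pi([set: gT])) = pi.-elt x.
Proof.
have hallP := nilpotent_pcore_Hall pi nil_abelianT.
by rewrite (mem_normal_Hall hallP) ?pcore_normal ?inE.
Qed.

Definition to_pair x : subg_of P * subg_of Q := (subg P x.`_p, subg Q x.`_p^').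

Definition of_pair (u : subg_of P * subg_of Q) : gT := sgval u.1 * sgval u.2.

Lemma sgval_to_pair x :
  sgval (to_pair x).1 = x.`_p /\ sgval (to_pair x).2 = x.`_p^'.
Proof. by split; apply: subgK; rewrite mem_pcoreT p_elt_constt. Qed.

Lemma to_pairK : cancel to_pair of_pair.
Proof.
move=> x; have [defp defq] := sgval_to_pair x.
by rewrite /of_pair defp defq consttC.
Qed.

Lemma of_pairK : cancel of_pair to_pair.
Proof.
case=> u w; have [pu pw] := (subgP u, subgP w).
rewrite !mem_pcoreT in pu pw.
have cuw: commute (sgval u) (sgval w) by apply: (centsP cGG); rewrite inE.
have /constt1P u1: (p^')^'.-elt (sgval u) by rewrite /p_elt pnatNK.
rewrite /to_pair /of_pair /= !consttM // u1 mul1g (constt1P pw) mulg1.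
by rewrite (constt_p_elt pu) (constt_p_elt pw) !sgvalK.
Qed.

(** The edges of the difference graph on a whole group type; over [subg_of G] this is convertible to
    the relation of [edge_diff]. *)
Definition diff_rel : rel gT := fun x y =>
  ((x != y) && cyclic <<[set x; y]>>) &&
  ~~ ((x != y) && ((x \in <[y]>) || (y \in <[x]>))).

(** An enhanced edge means comparability in both coordinates, a power edge that both inclusions go
    the same way; what remains is strict inclusion in opposite directions. *)
Lemma padj_to_pair : {mono to_pair : x y / diff_rel x y >-> padj x y}.
Proof.
move=> x y; rewrite /padj -!clt_sgval.
have [-> ->] := sgval_to_pair x; have [-> ->] := sgval_to_pair y.
rewrite /diff_rel cyclic_gen2 !(mem_cycle_constt p x) !(mem_cycle_constt p y).
have [-> | _] := eqVneq x y; first by rewrite !cltxx.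
rewrite /clt !properE /=.
by do !case: (_ \subset _).
Qed.

Lemma core_iso_to_pair :
  core_iso diff_rel (@padj (subg_of P) (subg_of Q)) to_pair of_pair.
Proof.
split=> [|u w|x y _|u w _]; first exact: padj_to_pair.
- by rewrite -padj_to_pair !of_pairK.
- exact: to_pairK.
- exact: of_pairK.
Qed.

End DifferencePairs.

(** * Exchange of the sides and assembly of the Sylow subgroups *)

Lemma core_iso_isog (pT qT pT' qT' : finGroupType) (p q p' q' : nat) f f' :
    abelian_pgroup_type p pT -> abelian_pgroup_type q qT -> p != q ->
    abelian_pgroup_type p' pT' -> abelian_pgroup_type q' qT' ->
    core_iso (@padj pT qT) (@padj pT' qT') f f' ->
  [set: pT] \isog [set: pT'] /\ [set: qT] \isog [set: qT']
  \/ [set: pT] \isog [set: qT'] /\ [set: qT] \isog [set: pT'].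
Proof.
move=> apP apQ neq_pq apP' apQ' fP.
have [ntP ntQ] := (ap_nontrivial apP, ap_nontrivial apQ).
have [ntP' ntQ'] := (ap_nontrivial apP', ap_nontrivial apQ').
have [b _ nt_b] := trivgPn _ ntQ; have sb := rside_axis ntP nt_b.
have ccb := core_iso_coconn (@padj_sym _ _) fP (coconn_rside sb).
case/orP: (coconn_sides ccb) => sfb; [left | right].
  have fS := side_iso_base ntP ntQ ntP' ntQ' fP sb sfb.
  exact: (side_iso_isog apP apQ neq_pq apP' apQ' fS).
(* Exchanging the two target groups reduces to the side-preserving case. *)
have gP := core_iso_comp fP (core_iso_swap pT' qT').
have gS := side_iso_base ntP ntQ ntQ' ntP' gP sb sfb.
exact: (side_iso_isog apP apQ neq_pq apQ' apP' gS).
Qed.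

Lemma abelian_pgroup_type_pcore (gT : finGroupType) (pi : nat_pred) (r : nat) :
    abelian [set: gT] -> prime r -> r %| #|[set: gT]| -> r \in pi ->
    r.-group 'O_pi([set: gT]) ->
  abelian_pgroup_type r (subg_of 'O_pi([set: gT])%G).
Proof.
move=> cGG r_pr r_dvd pi_r rO.
have isoO := isog_subg 'O_pi([set: gT])%G.
split=> //.
- by rewrite /pgroup -(card_isog isoO).
- by rewrite -(isog_abelian isoO) (abelianS (pcore_sub _ _)).
rewrite -(isog_eq1 isoO); have [x _ ox] := Cauchy r_pr r_dvd.
apply/trivgPn; exists x; last by rewrite -order_gt1 ox prime_gt1.
by rewrite mem_pcoreT // /p_elt ox pnatE.
Qed.

Lemma difference_graph_pairs (gT : finGroupType) (G : {group gT}) :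
    abelian G -> size (primes #|G|) = 2 ->
  exists p q (P Q : {group subg_of G}) f f',
    [/\ abelian_pgroup_type p (subg_of P), abelian_pgroup_type q (subg_of Q),
        p != q, P \x Q = [set: subg_of G]
      & core_iso (edge_diff (enhanced_power_graph G) (power_graph G))
                 (@padj (subg_of P) (subg_of Q)) f f'].
Proof.
move=> cGG; have isoG := isog_subg G; rewrite (card_isog isoG).
have cTT: abelian [set: subg_of G] by rewrite -(isog_abelian isoG).
case def_primes: (primes _) => [|p [|q []]] // _.
have mem_pq r : (r \in primes #|[set: subg_of G]|) = (r == p) || (r == q).
  by rewrite def_primes !inE.
have /and3P[p_pr _ p_dvd]: [&& prime p, 0 < #|[set: subg_of G]|
    & p %| #|[set: subg_of G]|] by rewrite -mem_primes mem_pq eqxx.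
have /and3P[q_pr _ q_dvd]: [&& prime q, 0 < #|[set: subg_of G]|
    & q %| #|[set: subg_of G]|] by rewrite -mem_primes mem_pq eqxx orbT.
have neq_pq: p != q.
  by have := primes_uniq #|[set: subg_of G]|; rewrite def_primes /= inE andbT.
have q_Q: q.-group 'O_p^'([set: subg_of G]).
  apply: sub_in_pnat (pcore_pgroup _ _) => r r_pi.
  have: r \in \pi(#|[set: subg_of G]|) by apply: piSg r_pi; apply: pcore_sub.
  by rewrite [r \in _]mem_pq !inE => /orP[]/eqP-> //; rewrite eqxx.
exists p, q, 'O_p([set: subg_of G])%G, 'O_p^'([set: subg_of G])%G.
exists (@to_pair _ p), (@of_pair _ p); split=> //.
- by apply: abelian_pgroup_type_pcore; rewrite ?inE ?pcore_pgroup.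
- by apply: abelian_pgroup_type_pcore; rewrite // !inE eq_sym.
- exact: nilpotent_pcoreC (abelian_nil cTT).
apply: (core_iso_to_pair cTT) => x; apply: mem_p_elt q_Q _.
by rewrite mem_pcoreT // p_elt_constt.
Qed.

Theorem theorem3p13 (gT kT : finGroupType) (G : {group gT}) (K : {group kT})
    (abG : abelian G) (abK : abelian K)
    (piG : size (primes #|G|) = 2) (piK : size (primes #|K|) = 2)
    (isoD : graph_iso (difference_graph G) (difference_graph K)) :
  G \isog K.
Proof.
(* The identity is a power of every element, hence isolated, and serves as the default vertex. *)
have isol (hT : finGroupType) (H : {group hT}) y :
    edge_diff (enhanced_power_graph H) (power_graph H) 1 y = false.
  apply/negP=> /andP[/andP[ne_y _]] /negP[].
  by apply/andP; split; rewrite // group1.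
have [F [F' FP]] := core_iso_delete_isolated (isol _ G) (isol _ K) isoD.
have [p [q [P [Q [f [f' [apP apQ neq_pq defG fP]]]]]]] :=
  difference_graph_pairs abG piG.
have [p' [q' [P' [Q' [e [e' [apP' apQ' _ defK eP]]]]]]] :=
  difference_graph_pairs abK piK.
have hP := core_iso_comp (core_iso_comp (core_iso_sym fP) FP) eP.
rewrite (isog_transl _ (isog_subg G)) (isog_transr _ (isog_subg K)) /=.
have isoS (hT lT : finGroupType) (H : {group hT}) (L : {group lT}) :
    [set: subg_of H] \isog [set: subg_of L] -> H \isog L.
  by rewrite (isog_transl _ (isog_subg H)) (isog_transr _ (isog_subg L)).
case: (core_iso_isog apP apQ neq_pq apP' apQ' hP) => -[/isoS iso1 /isoS iso2].
  exact: (isog_dprod defG defK iso1 iso2).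
by rewrite dprodC in defK; apply: (isog_dprod defG defK iso1 iso2).
Qed.
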